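(* For every integer $\Delta\ge 0$ there exist constants $C>0$ and $n_0$, depending only on $\Delta$, such that for every graph $G=(V,E)$ with $n=|V|\ge n_0$ vertices and maximum degree at most $\Delta$, and every integer $m\ge n$, the maximum load $X_{\max}^{(m)}$ after $m$ balls have been allocated by the local search allocation on $G$ satisfies $$\mathbf{Pr}\left[\,X_{\max}^{(m)}\le C\left(\frac{m}{n}+R_2(G)\right)\right]\ge 1-n^{-1}.$$
   Context: Graphs are finite and undirected, not necessarily connected. $d_G(u,v)$ is the graph distance ($\infty$ if $u,v$ lie in different components) and $B_u^r=\{v\in V: d_G(u,v)\le r\}$. With $\mathbb{N}=\{1,2,\dots\}$ and $\log$ the natural logarithm, define $$R_2(G)=\min\{r\in\mathbb{N}: r\,|B_u^r|\ge \log n\ \text{for all } u\in V\}.$$ Local search allocation on $G$: initially all vertices have load $0$. Balls $1,2,\dots$ arrive one at a time. Ball $i$ is born at a vertex $U_i$ (its birthplace) chosen independently and uniformly at random from $V$. Starting at its birthplace, in each step the ball moves to a neighbour of its current vertex having the smallest load among all neighbours, provided that this load is strictly smaller than the load of the current vertex; ties between smallest-load neighbours are broken independently and uniformly at random. The ball stops at the first vertex visited that has no neighbour of strictly smaller load, and it is allocated there, increasing that vertex's load by $1$. Then the next ball arrives. $X_v^{(m)}$ denotes the load of $v$ after $m$ balls have been allocated, and $X_{\max}^{(m)}=\max_{v\in V}X_v^{(m)}$. *)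

(* Defs.v *)
From mathcomp Require Import all_boot all_order all_algebra.
From mathcomp Require Import reals exp.

Set Implicit Arguments.
Unset Strict Implicit.
Unset Printing Implicit Defensive.

Import Order.TTheory GRing.Theory Num.Theory.
Local Open Scope ring_scope.

(* A finite graph is a symmetric irreflexive relation [e] on a finite type;
   these two properties are hypotheses of the statements. *)

Section Graph.
Variables (V : finType) (e : rel V).
Implicit Types (u v : V) (r k : nat).

Definition neighbours u : {set V} := [set v | e u v].

Definition max_degree : nat := \max_(u : V) #|neighbours u|.

Definition has_walk k u v : bool :=
  [exists p : k.-tuple V, path e u p && (last u p == v)].

Lemma connect_has_walk u v : exists k, connect e u v ==> has_walk k u v.
Proof.
have [/connectP[p ep ->]|] := boolP (connect e u v); last by exists 0%N.
exists (size p); apply/existsP; exists (in_tuple p).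
by rewrite /= ep eqxx.
Qed.

(* [None] stands for infinite distance. *)
Definition gdist u v : option nat :=
  if connect e u v then Some (ex_minn (connect_has_walk u v)) else None.

Definition gball u r : {set V} :=
  [set v | if gdist u v is Some d then (d <= r)%N else false].

Lemma gball_center u r : u \in gball u r.
Proof.
rewrite inE /gdist; case: ex_minnP => d _ /(_ 0%N); rewrite connect0 => d0.
apply: leq_trans (d0 _) _ => //=.
by apply/existsP; exists [tuple]; rewrite /= eqxx.
Qed.

End Graph.

Section R2.
Variables (R : realType) (V : finType) (e : rel V).

Definition R2_cond (r : nat) : bool :=
  (0 < r)%N && [forall u : V, ln (#|V|%:R : R) <= (r * #|gball e u r|)%:R].

Lemma R2_cond_ex : exists r, R2_cond r.
Proof.
exists (Num.bound `|ln (#|V|%:R : R)|).+1; apply/andP; split=> //.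
apply/forallP => u; set b := Num.bound _.
have /ltW lb : `|ln (#|V|%:R : R)| < b%:R by apply: archi_boundP.
apply: le_trans (le_trans (ler_norm _) lb) _.
rewrite ler_nat (leq_trans (leqnSn b)) // leq_pmulr //.
by rewrite card_gt0; apply/set0Pn; exists u; apply: gball_center.
Qed.

Definition R2 : nat := ex_minn R2_cond_ex.

End R2.

Section LocalSearch.
Variables (R : realType) (V : finType) (e : rel V).
Implicit Types (x : V -> nat) (u v : V).

Definition lightest x u : {set V} :=
  [set v in neighbours e u | [forall w in neighbours e u, (x v <= x w)%N]].

(* The possible next positions of a ball at [u]; the ball stops at [u] when
   there is none. *)
Definition moves x u : {set V} := [set v in lightest x u | (x v < x u)%N].

Fixpoint walk_prob (k : nat) x u v : R :=
  if moves x u == set0 then (u == v)%:R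
  else if k is k'.+1
  then #|moves x u|%:R^-1 * \sum_(w in moves x u) walk_prob k' x w v
  else 0.

(* The probability that a ball born at [u] is allocated to [v] when the loads
   are [x]. A ball at [u] makes at most [x u] moves since each move strictly
   decreases the load of its position, so no mass is lost by the cutoff: see
   [stop_probE]. *)
Definition stop_prob x u v : R := walk_prob (x u) x u v.

Lemma walk_prob_fuel k x u v : (x u <= k)%N -> walk_prob k x u v = stop_prob x u v.
Proof.
rewrite /stop_prob; elim/ltn_ind: k u => k IH u.
case: (posnP (x u)) => [xu0 _|xu0 xuk].
  suff m0 : moves x u = set0 by case: k {IH} => [|k]; rewrite xu0 /= m0 eqxx.
  by apply/setP => w; rewrite inE xu0 ltn0 andbF inE.
case: k xuk IH => [|k] xuk IH; first by move: (leq_trans xu0 xuk).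
case E : (x u) xu0 xuk => [//|j] _ jk /=; case: ifP => // _.
congr (_ * _); apply: eq_bigr => w; rewrite inE E ltnS => /andP[_ xwj].
by rewrite !IH // (leq_trans xwj).
Qed.

Lemma stop_probE x u v :
  stop_prob x u v =
  if moves x u == set0 then (u == v)%:R
  else #|moves x u|%:R^-1 * \sum_(w in moves x u) stop_prob x w v.
Proof.
rewrite -(walk_prob_fuel v (leqnSn (x u))) /=; case: ifP => // _.
congr (_ * _); apply: eq_bigr => w; rewrite inE => /andP[_ /ltnW].
exact: walk_prob_fuel.
Qed.

Lemma stop_prob_sum1 x u : \sum_v stop_prob x u v = 1.
Proof.
have [k] := ubnP (x u); elim: k u => // k IH u xuk.
under eq_bigr => v _ do rewrite stop_probE.
have [m0|m0] := eqVneq (moves x u) set0.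
  by rewrite (bigD1 u) //= eqxx big1 ?addr0 // => v /negPf; rewrite eq_sym => ->.
rewrite -mulr_sumr exchange_big /=.
rewrite (eq_bigr (fun=> 1)); last first.
  move=> w; rewrite inE => /andP[_ xwu]; apply: IH.
  by rewrite (leq_trans xwu) // -ltnS.
by rewrite sumr_const mulVf // pnatr_eq0 cards_eq0.
Qed.

(* A history lists the pairs (birthplace, allocated vertex) of successive
   balls. *)
Definition load (h : seq (V * V)) : V -> nat := fun v => count_mem v (unzip2 h).

Definition max_load (h : seq (V * V)) : nat := \max_(v : V) load h v.

Definition history_prob (h : seq (V * V)) : R :=
  \prod_(i < size h)
    let: (u, v) := tnth (in_tuple h) i in
    #|V|%:R^-1 * stop_prob (load (take i h)) u v.

Definition Pr (m : nat) (E : pred (seq (V * V))) : R :=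
  \sum_(h : m.-tuple (V * V) | E h) history_prob h.

Lemma history_prob_rcons h u v :
  history_prob (rcons h (u, v)) =
  history_prob h * (#|V|%:R^-1 * stop_prob (load h) u v).
Proof.
rewrite /history_prob.
pose F h' i := let: (u', v') := nth (u, v) h' i in
  #|V|%:R^-1 * stop_prob (load (take i h')) u' v'.
have FE h' : \prod_(i < size h') (let: (u', v') := tnth (in_tuple h') i in
    #|V|%:R^-1 * stop_prob (load (take i h')) u' v') = \prod_(i < size h') F h' i.
  by apply: eq_bigr => i _; rewrite (tnth_nth (u, v)).
rewrite !FE size_rcons big_ord_recr /= {2}/F nth_rcons ltnn eqxx.
rewrite -cats1 take_size_cat //; congr (_ * _); apply: eq_bigr => i _.
by rewrite /F nth_cat ltn_ord takel_cat // ltnW.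
Qed.

Lemma Pr_predT m : (0 < #|V|)%N -> Pr m predT = 1.
Proof.
move=> V0; rewrite /Pr; elim: m => [|m IH].
  rewrite (big_pred1 [tuple]) => [|h]; last by rewrite [h]tuple0 /= eqxx.
  by rewrite /history_prob big_ord0.
pose f (p : m.-tuple (V * V) * (V * V)) : m.+1.-tuple (V * V) :=
  [tuple of rcons p.1 p.2].
have fbij : bijective f.
  apply: inj_card_bij; last by rewrite card_prod !card_tuple expnSr.
  move=> [h p] [h' p'] /(congr1 val) /= /rcons_inj [hh ->].
  by congr (_, _); apply: val_inj.
rewrite (reindex f) /=; last exact: onW_bij.
rewrite -(pair_big predT predT (fun (h : m.-tuple (V * V)) p =>
  history_prob (rcons h p))) /= -IH.
apply: eq_bigr => h _.
rewrite (eq_bigr (fun p => history_prob (rcons h (p.1, p.2)))); last by case.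
rewrite -(pair_big predT predT (fun u v => history_prob (rcons h (u, v)))) /=.
under eq_bigr => u _.
  under eq_bigr => v _ do rewrite history_prob_rcons.
  rewrite -!mulr_sumr stop_prob_sum1 mulr1; over.
rewrite sumr_const -mulrnAr -[_^-1 *+ _]mulr_natr mulVf ?mulr1 //.
by rewrite pnatr_eq0 -lt0n.
Qed.

End LocalSearch.

(* Main.v *)
Require Import Defs.
From mathcomp Require Import all_boot all_order all_algebra.
From mathcomp Require Import perm reals sequences exp ring lra.

(* Fix a vertex v, let r = R_2(G) and S = B_v^r. Adjacent loads differ by at
   most 1, so X_v > T forces X_w >= T - r on all of S. This event is controlled
   by the potential
     Theta(X) = \sum_sigma \prod_(w in S) c^(X_(sigma w) - d(w, sigma w)),
   where sigma ranges over the INJECTIVE maps S -> V and c is large with respect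
   to Delta; the identity alone gives Theta >= c^((T - r)|S|) on the event.
   A ball born at u and allocated to z multiplies by c the terms whose sigma has
   z in its image. As X_u >= X_z + d(u, z), exchanging u and z in sigma does not
   decrease the weight, so these terms are at most twice those with u in the
   image. Injectivity bounds the sum over u of the latter by |S| Theta, so
   E[Theta] grows by a factor of at most 1 + 2(c - 1)|S|/n per ball. Markov's
   inequality then gives Pr[X_v > T] <= exp(|S| (O(m/n) + 1 + r - T)), which is
   at most exp(-2r|S|) <= n^(-2) for T = C (m/n + r). *)

Set Implicit Arguments.
Unset Strict Implicit.
Unset Printing Implicit Defensive.

Import Order.TTheory GRing.Theory Num.Theory.
Local Open Scope ring_scope.

(** * Weighted sums over injective maps *)

Section InjectiveSum.
Variables (R : numDomainType) (I V : finType).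
Implicit Types (y : I -> V -> R) (s : {ffun I -> V}) (u v : V).

(** This is the permanent of the rectangular matrix [y]. *)
Definition inj_sum y : R :=
  \sum_(s : {ffun I -> V} | injectiveb s) \prod_i y i (s i).

Definition inj_sum_through y v : R :=
  \sum_(s : {ffun I -> V} | injectiveb s && (v \in codom s)) \prod_i y i (s i).

Lemma inj_sum_ge_prod y (s : {ffun I -> V}) : (forall i u, 0 <= y i u) ->
  injective s -> \prod_i y i (s i) <= inj_sum y.
Proof.
move=> y0 /injectiveP sinj; rewrite /inj_sum (bigD1 s) //= lerDl.
by apply: sumr_ge0 => t _; apply: prodr_ge0.
Qed.

Lemma inj_sum_le y : (forall i u, 0 <= y i u) ->
  inj_sum y <= \prod_i \sum_u y i u.
Proof.
move=> y0; rewrite bigA_distr_bigA /inj_sum [leRHS](bigID (fun s => injectiveb s)) /=.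
by rewrite lerDl; apply: sumr_ge0 => t _; apply: prodr_ge0.
Qed.

(** An injection takes the value [v] at most once, so its product gains a single factor [c] if [v]
    lies in its image and none otherwise. *)
Lemma inj_sum_scale1 y v (c : R) :
  inj_sum (fun i u => y i u * c ^+ (u == v)) =
  inj_sum y + (c - 1) * inj_sum_through y v.
Proof.
rewrite /inj_sum_through mulr_sumr big_mkcondr -big_split /=.
apply: eq_bigr => s /injectiveP sinj; rewrite big_split /= [RHS]addrC.
have -> : \prod_i c ^+ (s i == v) = if v \in codom s then c else 1.
  case: ifPn => [/codomP[i vE]|vNs].
    rewrite (bigD1 i) //= vE eqxx expr1 big1 ?mulr1 // => j jNi.
    by rewrite (inj_eq sinj) (negPf jNi).
  rewrite big1 // => i _.
  by case: eqP vNs => // <-; rewrite codom_f.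
case: ifP => _; last by rewrite add0r mulr1.
by rewrite mulrBl mul1r subrK mulrC.
Qed.

(* An injection through [v] that avoids [u] becomes, after the exchange of [u]
   and [v], one through [u] of at least the same weight. *)
Lemma inj_sum_through_le y u v : (forall i w, 0 <= y i w) ->
  (forall i, y i v <= y i u) ->
  inj_sum_through y v <= 2 * inj_sum_through y u.
Proof.
move=> y0 yvu; rewrite /inj_sum_through.
pose W s := \prod_i y i (s i).
have W0 s : 0 <= W s by apply: prodr_ge0.
(* One copy of the right side pays for the injections through both vertices, the other for those
   that avoid [u]. *)
rewrite (bigID (fun s : {ffun I -> V} => u \in codom s)) /= mulr_natl mulr2n.
apply: lerD.
  rewrite big_mkcond [leRHS]big_mkcond /=; apply: ler_sum => s _.
  by case: injectiveb; case: (v \in _); case: (u \in _) => //=; apply: W0.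
pose f (s : {ffun I -> V}) := [ffun i => tperm u v (s i)].
have ff : involutive f by move=> s; apply/ffunP=> i; rewrite !ffunE tpermK.
have f_codom s w : (w \in codom (f s)) = (tperm u v w \in codom s).
  apply/codomP/codomP => -[i]; rewrite ?ffunE => E; exists i.
    by rewrite E tpermK.
  by rewrite ffunE -E tpermK.
have f_inj s : injectiveb (f s) = injectiveb s.
  apply/injectiveP/injectiveP => si i j.
    by move=> E; apply: si; rewrite !ffunE E.
  by rewrite !ffunE => /perm_inj; apply: si.
rewrite [leRHS](reindex_inj (inv_inj ff)) /=.
under [leRHS]eq_bigl => s do rewrite f_inj f_codom tpermL.
rewrite [leRHS](bigID (fun s : {ffun I -> V} => u \in codom s)) /=.
rewrite ler_wpDl //; first by apply: sumr_ge0 => s _; apply: W0.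
apply: ler_sum => s /andP[_ uNs]; apply: ler_prod => i _; rewrite y0 ffunE.
case: tpermP => [E|->|_ _]; rewrite ?yvu ?lexx //.
by rewrite -E codom_f in uNs.
Qed.

(** Double counting: the image of each injection has exactly [#|I|] elements. *)
Lemma sum_inj_sum_through y : \sum_v inj_sum_through y v = #|I|%:R * inj_sum y.
Proof.
rewrite /inj_sum_through /inj_sum.
under eq_bigr do rewrite big_mkcondr /=.
rewrite exchange_big /= mulr_sumr; apply: eq_bigr => s /injectiveP sinj.
by rewrite -big_mkcond /= sumr_const card_codom // mulr_natl.
Qed.

End InjectiveSum.

(** * Walks and graph distance *)

Section Graph.
Variables (V : finType) (e : rel V).
Implicit Types (u v w : V) (k d : nat).

Lemma has_walkP k u v :
  reflect (exists p, [/\ size p = k, path e u p & last u p = v]) (has_walk e k u v).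
Proof.
apply: (iffP existsP) => [[p /andP[ep /eqP<-]]|[p [<- ep <-]]].
  by exists p; rewrite size_tuple.
by exists (in_tuple p); rewrite /= ep eqxx.
Qed.

Lemma gdist_walk u v d : gdist e u v = Some d -> has_walk e d u v.
Proof.
rewrite /gdist; case: ifP => // uv [<-].
by case: ex_minnP => m; rewrite uv.
Qed.

Lemma walk_gdist k u v :
  has_walk e k u v -> exists2 d, gdist e u v = Some d & (d <= k)%N.
Proof.
move=> kuv; have uv : connect e u v.
  by have /has_walkP[p [_ ep <-]] := kuv; apply/connectP; exists p.
rewrite /gdist; case: ifP => [_|]; last by rewrite uv.
eexists; first by [].
by case: ex_minnP => d _; apply; rewrite uv.
Qed.

Lemma has_walk_rcons k u v w : has_walk e k u v -> e v w -> has_walk e k.+1 u w.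
Proof.
move=> /has_walkP[p [<- ep <-]] evw; apply/has_walkP; exists (rcons p w).
by rewrite size_rcons rcons_path last_rcons ep.
Qed.

Lemma card_walks k u : (#|[set v | has_walk e k u v]| <= max_degree e ^ k)%N.
Proof.
elim: k u => [|k IH] u.
  apply: (@leq_trans #|[set u]|); last by rewrite cards1.
  apply/subset_leq_card/subsetP => v; rewrite !inE.
  by move=> /has_walkP[[|w p] []] //= _ _ ->.
apply: (@leq_trans #|\bigcup_(w in neighbours e u) [set v | has_walk e k w v]|).
  apply/subset_leq_card/subsetP => v; rewrite inE => /has_walkP[[|w p] [] //=].
  move=> [sp] /andP[euw ep] pv; apply/bigcupP; exists w; first by rewrite inE.
  by rewrite inE; apply/has_walkP; exists p.
apply: (@leq_trans (\sum_(w in neighbours e u) max_degree e ^ k)%N).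
  elim/big_ind2: _ => [|A i B j Ai Bj|w _]; [by rewrite cards0 | | exact: IH].
  by rewrite (leq_trans (leq_card_setU _ _)) ?leq_add.
rewrite sum_nat_const expnS leq_mul2r; apply/orP; right.
exact: (leq_bigmax (F := fun u => #|neighbours e u|)).
Qed.

End Graph.

(** * Weights that decay geometrically with the distance *)

Section DistanceDecay.
Variables (R : realType) (V : finType) (e : rel V) (c : R).
Implicit Types (u v w : V).

(** The value [0] is the limit of [c ^- d] at infinite distance when [1 < c]; it confines the weight
    to the component of [w]. *)
Definition decay w u : R := if gdist e w u is Some d then c ^- d else 0.

Hypothesis c1 : 1 <= c.

Let c0 : 0 < c. Proof. exact: lt_le_trans c1. Qed.

Lemma decay_ge0 w u : 0 <= decay w u.
Proof. by rewrite /decay; case: gdist => // d; rewrite invr_ge0 exprn_ge0 // ltW. Qed.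

Lemma decay_refl w : decay w w = 1.
Proof.
rewrite /decay; have [|d -> ] := @walk_gdist _ e 0 w w.
  by apply/has_walkP; exists [::].
by rewrite leqn0 => /eqP->; rewrite expr0 invr1.
Qed.

Lemma decay_edge w u v : symmetric e -> e u v -> decay w v <= c * decay w u.
Proof.
move=> esym euv; rewrite {1}/decay; case E : gdist => [d|]; last first.
  by rewrite mulr_ge0 ?decay_ge0 // ltW.
have [] := walk_gdist (has_walk_rcons (gdist_walk E) _ : has_walk e d.+1 w u).
  by rewrite esym.
move=> d'; rewrite /decay => -> d'd.
rewrite -[leLHS]mul1r ler_pdivrMr ?exprn_gt0 // mulrAC -exprS.
by rewrite ler_pdivlMr ?exprn_gt0 // mul1r ler_weXn2l.
Qed.

(** At most [max_degree e ^ k] vertices end a walk of length [k] from [w], so length [k] contributes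
    at most [2 ^- k]. *)
Lemma sum_decay_le2 w : 2 * (max_degree e)%:R <= c -> \sum_u decay w u <= 2.
Proof.
(* [N] exceeds every finite distance from [w]; unreachable vertices count as [0] in the maximum. *)
move=> cdeg; pose N := (\max_u odflt 0 (gdist e w u)).+1.
have dN u : decay w u <= \sum_(k < N) (has_walk e k w u)%:R * c ^- k.
  rewrite /decay; case E : gdist => [d|]; last first.
    by apply: sumr_ge0 => k _; rewrite mulr_ge0 // invr_ge0 exprn_ge0 // ltW.
  have dN : (d < N)%N.
    by rewrite ltnS (leq_trans _ (leq_bigmax u)) // E.
  rewrite (bigD1 (Ordinal dN)) //= (gdist_walk E) mul1r lerDl.
  by apply: sumr_ge0 => k _; rewrite mulr_ge0 // invr_ge0 exprn_ge0 // ltW.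
apply: le_trans (ler_sum _ (fun u _ => dN u)) _; rewrite exchange_big /=.
(* The subtracted remainder is what makes the induction close. *)
have geo n : \sum_(k < n) (2 ^- k : R) <= 2 - 2 ^- n * 2.
  elim: n => [|n IH]; first by rewrite big_ord0 expr0 invr1 mul1r subrr.
  rewrite big_ord_recr /=; apply: le_trans (lerD IH (lexx _)) _.
  rewrite exprSr invfM mulfVK ?pnatr_eq0 //.
  by rewrite mulr_natr mulr2n opprD addrA subrK.
apply: le_trans (le_trans (geo N) _); last by rewrite gerBl mulr_ge0 // invr_ge0 exprn_ge0.
apply: ler_sum => k _; rewrite -mulr_suml -natr_sum.
rewrite ler_pdivrMr ?exprn_gt0 //.
rewrite [leRHS]mulrC ler_pdivlMr ?exprn_gt0 //.
have -> : (\sum_u has_walk e k w u = #|[set u | has_walk e k w u]|)%N.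
  by rewrite -sum1dep_card [RHS]big_mkcond; apply: eq_bigr => u _; case: has_walk.
apply: (@le_trans _ _ ((max_degree e)%:R ^+ k * 2 ^+ k)).
  by rewrite ler_pM2r ?exprn_gt0 // -natrX ler_nat card_walks.
by rewrite -exprMn lerXn2r ?nnegrE ?mulr_ge0 ?(ltW c0) // mulrC.
Qed.

End DistanceDecay.

(** * The allocation process and the smoothness of its loads *)

Section Process.
Variables (R : realType) (V : finType) (e : rel V).
Implicit Types (x : V -> nat) (u v w : V) (h : seq (V * V)).

Lemma stop_prob_ge0 x u v : 0 <= stop_prob R e x u v.
Proof.
have [k] := ubnP (x u); elim: k u => // k IH u xuk; rewrite stop_probE.
case: ifP => // _; rewrite mulr_ge0 ?invr_ge0 ?ler0n //; apply: sumr_ge0 => w.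
rewrite inE => /andP[_ xwu]; apply: IH.
by rewrite (leq_trans xwu) // -ltnS.
Qed.

(** Induction on the load of the start, which every move lowers: a nonzero stopping probability
    needs a first move from which it is still nonzero. *)
Lemma stop_prob_ind (P : V -> V -> Prop) x :
  (forall u, moves e x u = set0 -> P u u) ->
  (forall u w v, w \in moves e x u -> P w v -> P u v) ->
  forall u v, stop_prob R e x u v != 0 -> P u v.
Proof.
move=> P0 Pstep u v; have [k] := ubnP (x u); elim: k u => // k IH u xuk.
rewrite stop_probE; have [/P0 Pu|_] := eqVneq (moves e x u) set0.
  by rewrite pnatr_eq0 eqb0 negbK => /eqP<-.
rewrite mulf_eq0 negb_or => /andP[_] /negP sum_neq0.
have [/exists_inP[w wm pw]|] :=
  boolP [exists w in moves e x u, stop_prob R e x w v != 0].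
  apply: (Pstep _ _ _ wm); apply: IH => //.
  by move: wm; rewrite inE => /andP[_ xwu]; rewrite (leq_trans xwu) // -ltnS.
move=> /exists_inPn all0; case: sum_neq0; apply/eqP.
by rewrite big1 // => w /all0; rewrite negbK => /eqP.
Qed.

Lemma moves_eq0_le x u v : moves e x u = set0 -> e u v -> (x u <= x v)%N.
Proof.
move=> mu0 euv; rewrite leqNgt; apply/negP => xvu.
have vN : v \in neighbours e u by rewrite inE.
have [w wN wmin] := arg_minnP x vN.
have : w \in moves e x u.
  rewrite inE (leq_ltn_trans (wmin v vN)) // andbT inE; apply/andP; split=> //.
  by apply/forallP => w'; apply/implyP; apply: wmin.
by rewrite mu0 inE.
Qed.

Lemma history_prob_ge0 h : 0 <= history_prob R e h.
Proof.
apply: prodr_ge0 => i _; case: (tnth _ i) => u v.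
by rewrite mulr_ge0 ?invr_ge0 ?ler0n // stop_prob_ge0.
Qed.

Lemma load_rcons h u v w : load (rcons h (u, v)) w = (load h w + (w == v))%N.
Proof. by rewrite /load /unzip2 map_rcons -cats1 count_cat /= addn0 eq_sym. Qed.

(** A ball is placed only where no neighbour has a smaller load, so raising that load by one leaves
    it at most one above its neighbours. *)
Lemma load_edge h u v : symmetric e -> history_prob R e h != 0 -> e u v ->
  (load h u <= (load h v).+1)%N.
Proof.
move=> esym; elim/last_ind: h u v => [|h [b z] IH] u v; first by [].
rewrite history_prob_rcons !mulf_eq0 !negb_or => /and3P[h0 _ p0] euv.
have uv := IH _ _ h0 euv; have vu : (load h v <= (load h u).+1)%N.
  by apply: IH; rewrite // esym.
have z0 : moves e (load h) z = set0.
  by apply: (stop_prob_ind (P := fun _ v => moves e (load h) v = set0)) p0.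
rewrite !load_rcons.
have [uz|_] := eqVneq u z; last by rewrite addn0 -addSn (leq_trans uv) ?leq_addr.
have := moves_eq0_le z0; rewrite -uz => /(_ v euv) uv'.
by rewrite addn1 ltnS (leq_trans uv') // leq_addr.
Qed.

Lemma load_gball h v w r : symmetric e -> history_prob R e h != 0 ->
  w \in gball e v r -> (load h v <= load h w + r)%N.
Proof.
move=> esym h0; rewrite inE; case E : gdist => [d|//] dr.
have /has_walkP[p [sp ep <-]] := gdist_walk E.
apply: (leq_trans _ (leq_add (leqnn _) dr)); rewrite -{}sp {E dr}.
elim: p v ep => [|z p IH] v /=; first by rewrite addn0.
move=> /andP[evz ep]; rewrite addnS (leq_trans (load_edge esym h0 evz)) //.
by rewrite ltnS IH.
Qed.

Lemma sum_history_rcons m (F : seq (V * V) -> R) :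
  \sum_(h : m.+1.-tuple (V * V)) F h =
  \sum_(h : m.-tuple (V * V)) \sum_u \sum_v F (rcons h (u, v)).
Proof.
pose f (p : m.-tuple (V * V) * (V * V)) : m.+1.-tuple (V * V) :=
  [tuple of rcons p.1 p.2].
have f_bij : bijective f.
  apply: inj_card_bij; last by rewrite card_prod !card_tuple expnSr.
  move=> [h p] [h' p'] /(congr1 val) /= /rcons_inj [hh ->].
  by congr (_, _); apply: val_inj.
rewrite (reindex f) /=; last exact: onW_bij.
rewrite -(pair_big predT predT (fun (h : m.-tuple (V * V)) p => F (rcons h p))) /=.
apply: eq_bigr => h _; rewrite pair_big /=.
by apply: eq_bigr => -[].
Qed.

(** * Expected growth of the potential *)

Section Potential.
Variables (I : finType) (q : I -> V -> R) (c : R).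
Hypotheses (c1 : 1 <= c) (q0 : forall i u, 0 <= q i u).
Hypothesis q_edge : forall i u v, e u v -> q i v <= c * q i u.

(** With [q] the decay around the vertices of a ball of the graph, [inj_sum (scaled x)] is the
    potential. *)
Definition scaled x i u : R := q i u * c ^+ x u.

Let scaled_ge0 x i u : 0 <= scaled x i u.
Proof. by rewrite mulr_ge0 // exprn_ge0 // (le_trans ler01). Qed.

(* Every step of the search lowers the load, which compensates the change of
   [q] along an edge. *)
Lemma scaled_stop x i u v : stop_prob R e x u v != 0 -> scaled x i v <= scaled x i u.
Proof.
apply: (stop_prob_ind (P := fun u v => scaled x i v <= scaled x i u)) => {u v} //.
move=> u w v wm /le_trans; apply.
move: wm; rewrite !inE => /andP[/andP[euw _] xwu]; rewrite /scaled.
apply: le_trans (ler_wpM2r _ (q_edge i euw)) _.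
  by rewrite exprn_ge0 // (le_trans ler01).
by rewrite [c * _]mulrC -mulrA -exprS ler_wpM2l // ler_weXn2l.
Qed.

Lemma inj_sum_scaled_rcons h u v :
  inj_sum (scaled (load (rcons h (u, v)))) =
  inj_sum (scaled (load h)) + (c - 1) * inj_sum_through (scaled (load h)) v.
Proof.
rewrite -inj_sum_scale1 /inj_sum; apply: eq_bigr => s _; apply: eq_bigr => i _.
by rewrite /scaled load_rcons exprD mulrA.
Qed.

(** The allocated vertex is traded for the birthplace at the cost of a factor 2; the birthplace is
    uniform, so double counting applies. *)
Lemma expected_inj_sum_step h :
  \sum_u \sum_v #|V|%:R^-1 * stop_prob R e (load h) u v *
    inj_sum (scaled (load (rcons h (u, v)))) <=
  (1 + 2 * (c - 1) * #|I|%:R / #|V|%:R) * inj_sum (scaled (load h)).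
Proof.
set x := load h; set T := inj_sum _.
have T0 : 0 <= T by apply: sumr_ge0 => s _; apply: prodr_ge0.
have thr u : \sum_v #|V|%:R^-1 * stop_prob R e x u v *
      inj_sum (scaled (load (rcons h (u, v)))) <=
    #|V|%:R^-1 * (T + (c - 1) * (2 * inj_sum_through (scaled x) u)).
  under eq_bigr do rewrite -mulrA inj_sum_scaled_rcons.
  rewrite -mulr_sumr ler_wpM2l ?invr_ge0 ?ler0n //.
  (* [B] depends on the birthplace alone, so it is spread over the endpoints, whose probabilities
     sum to 1, and compared termwise. *)
  set B := T + _; rewrite (_ : B = \sum_v stop_prob R e x u v * B); last first.
    by rewrite -mulr_suml stop_prob_sum1 mul1r.
  apply: ler_sum => v _; rewrite /B.
  have [->|p0] := eqVneq (stop_prob R e x u v) 0; first by rewrite !mul0r.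
  rewrite ler_wpM2l ?stop_prob_ge0 // lerD2l ler_wpM2l ?subr_ge0 //.
  by apply: inj_sum_through_le => // i; apply: scaled_stop.
apply: le_trans (ler_sum _ (fun u _ => thr u)) _.
rewrite -mulr_sumr big_split /= sumr_const -!mulr_sumr sum_inj_sum_through.
(* This is an inequality to cover empty [V], where the inverse is [0]. *)
have VT : #|V|%:R^-1 * (T *+ #|V|) <= T.
  rewrite -[T *+ _]mulr_natr mulrCA -[leRHS]mulr1 ler_wpM2l //.
  by have [->|n0] := eqVneq (#|V|%:R : R) 0; rewrite ?mulr0 // mulVf.
rewrite -/T mulrDr; apply: le_trans (lerD VT (lexx _)) _.
by rewrite le_eqVlt; apply/orP; left; apply/eqP; ring.
Qed.

(** The one-ball bound is iterated with [1 + x <= expR x]; at load zero, dropping injectivity turns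
    the sum into the product. *)
Lemma expected_inj_sum m :
  \sum_(h : m.-tuple (V * V)) history_prob R e h * inj_sum (scaled (load h)) <=
  expR (2 * (c - 1) * #|I|%:R * (m%:R / #|V|%:R)) * \prod_i \sum_u q i u.
Proof.
elim: m => [|m IH].
  rewrite (big_pred1 [tuple]) => [|h]; last by rewrite [h]tuple0 /= eqxx.
  rewrite /history_prob big_ord0 mul0r mulr0 expR0 !mul1r.
  apply: le_trans (inj_sum_le _) _ => //.
  by under eq_bigr do under eq_bigr do rewrite /scaled mulr1.
rewrite (sum_history_rcons m (fun h => history_prob R e h * inj_sum (scaled (load h)))).
set a := 2 * (c - 1) * #|I|%:R in IH *.
apply: (@le_trans _ _ (\sum_(h : m.-tuple (V * V)) (1 + a / #|V|%:R) *
    (history_prob R e h * inj_sum (scaled (load h))))).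
  apply: ler_sum => h _; under eq_bigr do under eq_bigr do
    rewrite history_prob_rcons -mulrA.
  under eq_bigr do rewrite -mulr_sumr.
  rewrite -mulr_sumr mulrCA ler_wpM2l ?history_prob_ge0 //.
  exact: expected_inj_sum_step.
have a0 : 0 <= a / #|V|%:R.
  by rewrite !mulr_ge0 ?invr_ge0 ?ler0n // subr_ge0.
rewrite -mulr_sumr; apply: le_trans (ler_wpM2l _ IH) _; first by rewrite addr_ge0.
rewrite mulrA ler_wpM2r //; first by apply: prodr_ge0 => i _; apply: sumr_ge0.
have -> : a * (m.+1%:R / #|V|%:R) = a / #|V|%:R + a * (m%:R / #|V|%:R).
  by rewrite -(natr1 m); ring.
rewrite expRD ler_wpM2r ?expR_ge0 //.
exact: expR_ge1Dx.
Qed.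

End Potential.
End Process.

(** * Tail bound for the load of one vertex *)

Lemma prob_load_gt (R : realType) (V : finType) (e : rel V) (c T : R) (m : nat)
    (v : V) (r : nat) :
  symmetric e -> expR 1 <= c -> 2 * (max_degree e)%:R <= c ->
  Pr R e m (fun h => T < (load h v)%:R) <=
  expR (#|gball e v r|%:R * (2 * (c - 1) * (m%:R / #|V|%:R) + 1 + r%:R - T)).
Proof.
move=> esym ce cdeg; set S := gball e v r.
have c1 : 1 <= c by apply: le_trans ce; apply: le_trans (expR_ge1Dx _); rewrite lerDl.
pose q (w : {w | w \in S}) u := decay e c (val w) u.
have cardS : #|{: {w | w \in S}}| = #|S| by rewrite card_sig.
have q0 i u : 0 <= q i u by apply: decay_ge0.
have q_edge i u w : e u w -> q i w <= c * q i u by apply: decay_edge.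
set L := expR (#|S|%:R * (T - r%:R)).
have L0 : 0 < L by apply: expR_gt0.
have big_inj h : history_prob R e h != 0 -> T < (load h v)%:R ->
    L <= inj_sum (scaled q c (load h)).
  (* The inclusion of [S] has all its decay factors equal to 1, so only the loads, each at least
     [T - r], remain. *)
  move=> h0 Tv; pose s : {ffun {w | w \in S} -> V} := [ffun w => val w].
  apply: le_trans (inj_sum_ge_prod (s := s) _ _).
  - rewrite /L expRM_natl -cardS -prodr_const.
    apply: ler_prod => w _; rewrite expR_ge0 /scaled /q ffunE decay_refl // mul1r.
    apply: (@le_trans _ _ (expR 1 ^+ load h (val w))).
      rewrite -expRM_natl mulr1 ler_expR lerBlDr -natrD.
      by apply: le_trans (ltW Tv) _; rewrite ler_nat (load_gball esym h0 (valP w)).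
    by rewrite lerXn2r ?nnegrE ?expR_ge0 // (le_trans ler01).
  - by move=> i u; rewrite mulr_ge0 // exprn_ge0 // (le_trans ler01).
  - by move=> i j; rewrite !ffunE => /val_inj.
have markov : Pr R e m (fun h => T < (load h v)%:R) * L <=
    \sum_(h : m.-tuple (V * V)) history_prob R e h * inj_sum (scaled q c (load h)).
  rewrite /Pr mulr_suml big_mkcond /=; apply: ler_sum => h _.
  have [h0|h0] := eqVneq (history_prob R e h) 0; first by rewrite h0 !mul0r; case: ifP.
  case: ifP => [Tv|_]; first by rewrite ler_wpM2l ?history_prob_ge0 // big_inj.
  rewrite mulr_ge0 ?history_prob_ge0 //; apply: sumr_ge0 => s _.
  by apply: prodr_ge0 => i _; rewrite mulr_ge0 // exprn_ge0 // (le_trans ler01).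
have := le_trans markov (expected_inj_sum c1 q0 q_edge m).
rewrite -ler_pdivlMr // cardS => /le_trans; apply.
rewrite ler_pdivrMr //.
(* Each factor is at most [2 <= expR 1], whence the summand 1 in the exponent. *)
have prod_le : \prod_(i : {w | w \in S}) \sum_u q i u <= expR (#|S|%:R).
  rewrite -[X in expR X]mulr1 expRM_natl -cardS -prodr_const.
  apply: ler_prod => i _; rewrite sumr_ge0 //=.
  apply: le_trans (sum_decay_le2 c1 _ cdeg) _.
  by have := expR_ge1Dx (1 : R); rewrite -mulr2n.
apply: le_trans (ler_wpM2l _ prod_le) _; first exact: expR_ge0.
by rewrite -!expRD ler_expR; lra.
Qed.

(** * Choice of constants and union bound over the vertices *)

Theorem theorem1p2 (R : realType) (Delta : nat) :
  exists (C : R) (n0 : nat), 0 < C /\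
    forall (V : finType) (e : rel V),
      symmetric e -> irreflexive e ->
      (n0 <= #|V|)%N -> (max_degree e <= Delta)%N ->
      forall m : nat, (#|V| <= m)%N ->
        1 - #|V|%:R^-1 <=
        Pr R e m (fun h => (max_load h)%:R <=
                           C * (m%:R / #|V|%:R + (R2 R e)%:R)).
Proof.
(* By [1 + x <= expR x] this exceeds [2 * Delta], as the decay sum needs, and it is at least
   [expR 1], as the lower bound on the potential needs. *)
pose c : R := expR (2 * Delta%:R + 1).
have D0 : (0 : R) <= 2 * Delta%:R by rewrite mulr_ge0.
have ce : expR 1 <= c by rewrite ler_expR lerDr.
have c1 : 1 <= c by apply: le_trans ce; apply: le_trans (expR_ge1Dx _); rewrite lerDl.
(* [2 * c] absorbs the growth rate [2 * (c - 1)]; [4] covers [1 + r <= 2 * r] and leaves the surplus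
   [2 * r] for the tail. The threshold 1 makes [V] nonempty. *)
exists (2 * c + 4), 1%N; split; first lra.
move=> V e esym _ V0 degD m _; set T := _ * _.
have cdeg : 2 * (max_degree e)%:R <= c.
  apply: (@le_trans _ _ (2 * Delta%:R)); first by rewrite ler_pM2l // ler_nat.
  by apply: le_trans (expR_ge1Dx _); lra.
have n0 : 0 < (#|V|%:R : R) by rewrite ltr0n.
set r := R2 R e in T *.
have [r0 rball] : (0 < r)%N /\
    forall v : V, ln (#|V|%:R : R) <= (r * #|gball e v r|)%:R.
  by rewrite /r /R2; case: ex_minnP => k /andP[k0 /forallP kv] _; split.
have tail v : Pr R e m (fun h => T < (load h v)%:R) <= #|V|%:R^-1 ^+ 2.
  set mu := m%:R / #|V|%:R in T *.
  apply: le_trans (prob_load_gt T m v r esym ce cdeg) _.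
  rewrite -/mu -[X in X^-1](lnK (x := #|V|%:R)) ?posrE // -expRN -expRM_natl ler_expR.
  have mu0 : 0 <= mu by rewrite divr_ge0.
  have r1 : (1 : R) <= r%:R by rewrite ler1n.
  have TE : 2 * (c - 1) * mu + 1 + r%:R - T <= - (2 * r%:R).
    by rewrite /T; nra.
  apply: le_trans (ler_wpM2l (ler0n _ _) TE) _.
  by have := rball v; rewrite natrM; lra.
have split_Pr : Pr R e m predT <=
    Pr R e m (fun h => (max_load h)%:R <= T) +
    \sum_v Pr R e m (fun h => T < (load h v)%:R).
  rewrite {1 2}/Pr (bigID (fun h : m.-tuple (V * V) => (max_load h)%:R <= T)) /=.
  rewrite lerD2l /Pr (exchange_big_dep predT) //=.
  rewrite big_mkcond /=; apply: ler_sum => h _; case: ifPn => [|_].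
    rewrite -ltNge => Th.
    (* A vertex attaining the maximum load witnesses the bad event. *)
    have [v vE] := bigop.eq_bigmax (load h) V0.
    rewrite (bigD1 v) /= ?lerDl -?vE //.
    by apply: sumr_ge0 => w _; apply: history_prob_ge0.
  by apply: sumr_ge0 => w _; apply: history_prob_ge0.
rewrite Pr_predT // in split_Pr.
rewrite lerBlDr; apply: le_trans split_Pr _; rewrite lerD2l.
apply: le_trans (ler_sum _ (fun v _ => tail v)) _.
rewrite sumr_const -[leLHS]mulr_natr expr2 -mulrA mulVf ?mulr1 //.
by rewrite gt_eqF.
Qed.
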